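(* Let $A$ be a complex semisimple Banach algebra with identity. Then $\mathrm{Soc}\,A$ is a minimal two-sided ideal of $A$ if and only if the following three conditions are equivalent for any $a \in A$ with $a \neq 0$ and any $b \in \mathrm{Soc}\,A$ with $b \neq 0$: (i) there is a nonempty open set $N \subseteq A$ such that $\sigma'(ax) \subseteq \sigma'(bx)$ for all $x \in N$; (ii) $\sigma'(ax) \subseteq \sigma'(bx)$ for all $x \in A$; (iii) $a = b$.
   Context: $\sigma(x)$ denotes the spectrum of $x \in A$ and $\sigma'(x) = \sigma(x) \setminus \{0\}$ its nonzero spectrum. $\mathrm{Soc}\,A$ is the socle of $A$ (the sum of the minimal left ideals of $A$, or $\{0\}$ if there are none); for semisimple $A$ it coincides with the set of $a \in A$ of finite rank, where $\mathrm{rank}(a) = \sup_{x \in A} \#\sigma'(xa)$. A minimal two-sided ideal means a two-sided ideal which does not contain any two-sided ideals other than $\{0\}$ and itself (so, by this convention, $\{0\}$ itself qualifies). *)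

(* Defs.v *)
From HB Require Import structures.
From mathcomp Require Import all_boot all_order all_algebra.
From mathcomp Require Import all_classical all_reals topology normedtype.
From mathcomp Require Import complex.

Set Implicit Arguments.
Unset Strict Implicit.
Unset Printing Implicit Defensive.

Import GRing.Theory Num.Theory.
Import numFieldNormedType.Exports.

Local Open Scope classical_set_scope.
Local Open Scope ring_scope.

(* Hierarchy-Builder cannot declare the join of CompleteNormedModule and
   GRing.Algebra as a structure (its meet with Num.NumDomain would not be
   unique), so Banach algebras are a record, whose carrier is then equipped
   with instances of both. The normalization `|1| = 1 is not required. *)
Record banachAlgType (K : numFieldType) := BanachAlgebra {
  banach_base : completeNormedModType K;
  banach_one : banach_base;
  banach_mul : banach_base -> banach_base -> banach_base;
  banach_mulA : associative banach_mul;
  banach_mul1x : left_id banach_one banach_mul;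
  banach_mulx1 : right_id banach_one banach_mul;
  banach_mulDl : left_distributive banach_mul +%R;
  banach_mulDr : right_distributive banach_mul +%R;
  banach_one_neq0 : banach_one != 0;
  banach_scaleAl : forall (k : K) (x y : banach_base),
    k *: banach_mul x y = banach_mul (k *: x) y;
  banach_scaleAr : forall (k : K) (x y : banach_base),
    k *: banach_mul x y = banach_mul x (k *: y);
  banach_norm_mul : forall x y : banach_base,
    `|banach_mul x y| <= `|x| * `|y|
}.

Definition banach_sort (K : numFieldType) (A : banachAlgType K) : Type :=
  banach_base A.
Coercion banach_sort : banachAlgType >-> Sortclass.

Section BanachAlgebraInstances.
Variables (K : numFieldType) (A : banachAlgType K).

HB.instance Definition _ :=
  CompleteNormedModule.copy (banach_sort A) (banach_base A).

HB.instance Definition _ := GRing.Zmodule_isNzRing.Build (banach_sort A)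
  (@banach_mulA K A) (@banach_mul1x K A) (@banach_mulx1 K A)
  (@banach_mulDl K A) (@banach_mulDr K A) (@banach_one_neq0 K A).

HB.instance Definition _ :=
  GRing.Lmodule_isLalgebra.Build K (banach_sort A) (@banach_scaleAl K A).

HB.instance Definition _ :=
  GRing.Lalgebra_isAlgebra.Build K (banach_sort A) (@banach_scaleAr K A).

Definition banach_unit : pred (banach_sort A) :=
  fun x => `[< exists y : banach_sort A, y * x = 1 /\ x * y = 1 >].

Definition banach_inv (x : banach_sort A) : banach_sort A :=
  xget x [set y : banach_sort A | y * x = 1 /\ x * y = 1].

Let banach_invP (x : banach_sort A) : banach_unit x ->
  banach_inv x * x = 1 /\ x * banach_inv x = 1.
Proof.
by move=> /asboolP[y xy]; rewrite /banach_inv; case: xgetP => [z _ //|/(_ y)].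
Qed.

Let banach_mulVx : {in banach_unit, left_inverse 1 banach_inv *%R}.
Proof. by move=> x /banach_invP[]. Qed.

Let banach_mulxV : {in banach_unit, right_inverse 1 banach_inv *%R}.
Proof. by move=> x /banach_invP[]. Qed.

Let banach_unitP (x y : banach_sort A) :
  y * x = 1 /\ x * y = 1 -> banach_unit x.
Proof. by move=> xy; apply/asboolP; exists y. Qed.

Let banach_inv_out : {in [predC banach_unit], banach_inv =1 id}.
Proof.
move=> x /negP xN; rewrite /banach_inv; case: xgetP => // y _ xy.
by case: xN; exact: banach_unitP xy.
Qed.

HB.instance Definition _ := GRing.NzRing_hasMulInverse.Build (banach_sort A)
  banach_mulVx banach_mulxV banach_unitP banach_inv_out.

End BanachAlgebraInstances.

Section Ideals.
Variable A : nzRingType.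
Implicit Types I J L M : set A.

(* In a unital algebra an ideal is automatically closed under opposites and
   under scalars, since - x = (- 1) * x and k *: x = k%:A * x. *)
Definition left_ideal I : Prop :=
  [/\ I 0, forall x y, I x -> I y -> I (x + y)
    & forall a x, I x -> I (a * x)].

Definition two_sided_ideal I : Prop :=
  left_ideal I /\ forall x a, I x -> I (x * a).

Definition maximal_left_ideal M : Prop :=
  [/\ left_ideal M, M <> setT
    & forall L, left_ideal L -> M `<=` L -> L = M \/ L = setT].

Definition jacobson_radical : set A :=
  \bigcap_(M in maximal_left_ideal) M.

Definition semisimple : Prop := jacobson_radical = [set 0].

Definition minimal_left_ideal L : Prop :=
  [/\ left_ideal L, L <> [set 0]
    & forall J, left_ideal J -> J `<=` L -> J = [set 0] \/ J = L].

(* Contrary to minimal_left_ideal, the zero ideal is allowed here. *)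
Definition minimal_two_sided_ideal I : Prop :=
  two_sided_ideal I /\
  forall J, two_sided_ideal J -> J `<=` I -> J = [set 0] \/ J = I.

(* The empty sum (n = 0) makes this [set 0] when there is no minimal left
   ideal. *)
Definition socle : set A :=
  [set a | exists (n : nat) (x : 'I_n -> A),
    (forall i, exists2 L, minimal_left_ideal L & L (x i)) /\
    a = \sum_(i < n) x i].

End Ideals.

Arguments semisimple : clear implicits.
Arguments socle : clear implicits.

Section Spectrum.
Variables (K : numFieldType) (A : unitAlgType K).

Definition spectrum (x : A) : set K :=
  [set l | l%:A - x \isn't a GRing.unit].

Definition nonzero_spectrum (x : A) : set K := spectrum x `\ 0.

End Spectrum.

(* Main.v *)
Require Import Defs.
From mathcomp Require Import all_boot all_order all_algebra.
From mathcomp Require Import all_classical all_reals topology normedtype.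
From mathcomp Require Import complex.
From mathcomp Require Import separable cyclic cyclotomic sequences lra.

Set Implicit Arguments.
Unset Strict Implicit.
Unset Printing Implicit Defensive.

Import Order.TTheory GRing.Theory Num.Theory.
Import numFieldNormedType.Exports.

Local Open Scope classical_set_scope.
Local Open Scope ring_scope.
Local Open Scope complex_scope.

(** Let L be a minimal left ideal of the semisimple algebra A. Then L = Ap for
an idempotent p whose corner pAp is a division algebra
([minimal_left_ideal_idempotent]), hence pAp = Cp by the Gelfand-Mazur theorem
([corner_scalar]): p z p = tau(z) p for a linear form tau.

Suppose that the socle is a minimal two-sided ideal and contains b <> 0. It is
then the ideal generated by p, and so b = sum_i s_i p t_i. The nonzero spectrum
of b x consists of the nonzero eigenvalues of the scalar matrix of entries
tau(t_j x s_i) ([finite_rank_spectrum]); its characteristic polynomial q_x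
depends polynomially on x along every line.

(i) implies (ii). Put u = a x. The inclusion of the spectra for x says that
u q_x(u) is quasinilpotent. Along a line through a point of N this element is a
polynomial in the complex parameter which is quasinilpotent on a disc. Such a
polynomial is quasinilpotent everywhere ([quasinilpotent_extension], an
elementary form of the subharmonicity of log of the spectral radius), and
quasinilpotence of u q_x(u) gives back the inclusion for x.

(ii) implies (iii). For x = s p t both spectra reduce to a single number, and
the inclusion says that tau(t a s) is 0 or tau(t b s). A group is not the union
of two proper subgroups; applied in t and then in s, this shows that c = a or
c = a - b annihilates Ap from the left, hence annihilates the whole socle by
minimality, on both sides by semiprimeness. For x = y c z one gets b x = 0 and
a x = c y c z. So c y c z has no nonzero spectrum for any z, whence
c y c = 0 for all y, and c = 0 ([spectrum_inclusion_eq]). As a <> 0, a = b.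

Conversely, if the socle properly contains a nonzero two-sided ideal J, there
are a minimal left ideal Ap inside J and another one Aq that meets J in 0. Then
p A q = q A p = 0, the nonzero spectrum of (p + q) x is the union of those of
p x and q x, and a = p, b = p + q satisfy (ii) but not (iii)
([unique_inclusion_minimal]).

The only analytic input beyond the Neumann series is the fact that
t^n ||x^n|| tends to 0 for every t when 1 - l x is invertible for all complex l
([quasinilpotent_powers]). It is obtained without contour integrals, by
averaging resolvents over roots of unity. *)

(** * Real-valued norms and the Neumann series *)

Section RealNorm.
Variable R : realType.

(** The norm takes its values in R[i], where the order is partial; its real part
carries the same information in the ordered field R. *)
Definition nrm (V : normedZmodType R[i]) (x : V) : R := complex.Re `|x|.

Section NormedZmod.
Variable V : normedZmodType R[i].
Implicit Types x y : V.

Lemma normr_nrm x : `|x| = (nrm x)%:C.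
Proof. by rewrite /nrm RRe_real ?normr_real. Qed.

Lemma nrm_ge0 x : 0 <= nrm x.
Proof. by have := normr_ge0 x; rewrite normr_nrm ler0c. Qed.

Lemma nrm0 : nrm (0 : V) = 0.
Proof. by rewrite /nrm normr0. Qed.

Lemma nrm_eq0 x : nrm x = 0 -> x = 0.
Proof. by move=> x0; apply/normr0_eq0; rewrite normr_nrm x0. Qed.

Lemma nrmN x : nrm (- x) = nrm x.
Proof. by rewrite /nrm normrN. Qed.

Lemma nrmD x y : nrm (x + y) <= nrm x + nrm y.
Proof. by rewrite -lecR rmorphD /= -!normr_nrm ler_normD. Qed.

Lemma nrmB x y : nrm (x - y) <= nrm x + nrm y.
Proof. by rewrite -(nrmN y) nrmD. Qed.

Lemma nrm_sum (I : Type) (s : seq I) (F : I -> V) :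
  nrm (\sum_(i <- s) F i) <= \sum_(i <- s) nrm (F i).
Proof.
elim: s => [|i s IHs]; first by rewrite !big_nil nrm0.
by rewrite !big_cons (le_trans (nrmD _ _)) // lerD2l.
Qed.

End NormedZmod.

Lemma nrmZ (V : normedModType R[i]) (k : R[i]) (x : V) :
  nrm (k *: x) = nrm k * nrm x.
Proof. by apply: complexI; rewrite rmorphM /= -!normr_nrm normrZ. Qed.

Lemma nrmCM (k l : R[i]) : nrm (k * l) = nrm k * nrm l.
Proof. by apply: complexI; rewrite rmorphM /= -!normr_nrm normrM. Qed.

Lemma nrmCX (k : R[i]) n : nrm (k ^+ n) = nrm k ^+ n.
Proof. by apply: complexI; rewrite rmorphXn /= -!normr_nrm normrX. Qed.

Lemma nrmCV (k : R[i]) : nrm k^-1 = (nrm k)^-1.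
Proof. by apply: complexI; rewrite fmorphV /= -!normr_nrm normfV. Qed.

Lemma nrm_real (t : R) : nrm t%:C = `|t|.
Proof. by rewrite /nrm normc_def /= expr0n addr0 sqrtr_sqr. Qed.

Lemma nrm_nat n : nrm (n%:R : R[i]) = n%:R.
Proof. by rewrite -(rmorph_nat (real_complex R)) nrm_real ger0_norm. Qed.

Lemma nrm_i : nrm ('i : R[i]) = 1.
Proof. by rewrite /nrm normc_def /= expr0n add0r expr1n sqrtr1. Qed.

Lemma nrmC1 : nrm (1 : R[i]) = 1.
Proof. by rewrite /nrm normr1. Qed.

Lemma expr_small (q e : R) : 0 <= q < 1 -> 0 < e ->
  exists N, forall n, (N <= n)%N -> q ^+ n <= e.
Proof.
move=> /andP[q0 q1] e0.
have /cvgr0Pnorm_le /(_ e e0) [N _ hN] : (fun n => q ^+ n) @ \oo --> (0 : R).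
  by apply: cvg_expr; rewrite ger0_norm.
by exists N => n /hN /=; rewrite ger0_norm // exprn_ge0.
Qed.

End RealNorm.

Section BanachNorm.
Variables (R : realType) (A : banachAlgType R[i]).
Implicit Types x y : A.

Lemma nrmM x y : nrm (x * y) <= nrm x * nrm y.
Proof. by rewrite -lecR rmorphM /= -!normr_nrm; exact: banach_norm_mul. Qed.

Lemma nrmXS x n : nrm (x ^+ n.+1) <= nrm x ^+ n.+1.
Proof.
elim: n => // n IHn; rewrite exprS (le_trans (nrmM _ _)) // [leRHS]exprS.
by rewrite ler_wpM2l // nrm_ge0.
Qed.

(** The factor 1 + ||1|| accounts for n = 0, since ||1|| may exceed 1. *)
Lemma nrmX x n : nrm (x ^+ n) <= (1 + nrm (1 : A)) * nrm x ^+ n.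
Proof.
case: n => [|n]; first by rewrite !expr0 mulr1; lra.
rewrite (le_trans (nrmXS x n)) // ler_peMl ?exprn_ge0 ?nrm_ge0 //.
by have := nrm_ge0 (1 : A); lra.
Qed.

Lemma mul1B_geometric_sum x n : (1 - x) * (\sum_(i < n) x ^+ i) = 1 - x ^+ n.
Proof. by rewrite -opprB mulNr -subrX1 opprB. Qed.

Lemma nrm_cauchy_cvg (u : nat -> A) :
  (forall e : R, 0 < e -> exists N, forall m n, (N <= m)%N -> (N <= n)%N ->
     nrm (u m - u n) <= e) ->
  exists l, forall e : R, 0 < e -> exists N, forall n, (N <= n)%N ->
     nrm (u n - l) <= e.
Proof.
move=> uC.
have real_eps (e : R[i]) : 0 < e -> exists2 r : R, 0 < r & e = r%:C.
  move=> e0; exists (complex.Re e); last by rewrite RRe_real // gtr0_real.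
  by move: e0; rewrite ltcE => /andP[].
have /cauchy_cvgP /cvg_ex [l ul] : cauchy (u @ \oo).
  apply: cauchy_exP => _ /real_eps [r r0 ->].
  have [|N hN] := uC (r / 2); first by rewrite divr_gt0.
  exists (u N); exists N => // n /= Nn.
  rewrite -ball_normE /ball_ /= normr_nrm ltcR.
  by rewrite (le_lt_trans (hN _ _ _ Nn)) // ltr_pdivrMr // mulr_natr mulr2n ltrDl.
exists l => e e0; move/cvgrPdist_le: ul => /(_ e%:C).
rewrite ltcR => /(_ e0) [N _ hN]; exists N => n /hN /=.
by rewrite normr_nrm lecR -nrmN opprB.
Qed.

Lemma neumann x : nrm x < 1 -> 1 - x \is a GRing.unit.
Proof.
move=> x1; have x0 := nrm_ge0 x.
have c0 := nrm_ge0 (1 : A).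
pose c := 1 + nrm (1 : A); have c_gt0 : 0 < c by rewrite /c; lra.
pose s n := \sum_(i < n) x ^+ i.
have sl n : (1 - x) * s n = 1 - x ^+ n by exact: mul1B_geometric_sum.
have sr n : s n * (1 - x) = 1 - x ^+ n.
  elim: n => [|n IHn]; first by rewrite /s big_ord0 mul0r expr0 subrr.
  rewrite /s big_ord_recr /= mulrDl IHn mulrBr mulr1 -exprSr.
  by rewrite addrA subrK.
have sE m n : (m <= n)%N -> nrm (s n - s m) <= c / (1 - nrm x) * nrm x ^+ m.
  move=> mn.
  have -> : s n - s m = \sum_(m <= i < n) x ^+ i.
    by rewrite /s -!(big_mkord xpredT (fun i => x ^+ i))
      (@big_cat_nat _ _ _ m) //= addrAC subrr add0r.
  rewrite (le_trans (nrm_sum _ _)) //.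
  apply: le_trans (_ : \sum_(m <= i < n) c * nrm x ^+ i <= _).
    by apply: ler_sum => i _; exact: nrmX.
  rewrite -mulr_sumr -mulrA ler_wpM2l ?(ltW c_gt0) // ler_pdivlMl ?subr_gt0 //.
  have -> : (1 - nrm x) * (\sum_(m <= i < n) nrm x ^+ i) = nrm x ^+ m - nrm x ^+ n.
    rewrite -opprB mulNr mulrBl mul1r mulr_sumr -sumrB.
    under eq_bigr do rewrite -exprS.
    by rewrite telescope_sumr // opprB.
  by rewrite gerBl exprn_ge0.
have [l hl] : exists l, forall e : R, 0 < e -> exists N, forall n, (N <= n)%N ->
     nrm (s n - l) <= e.
  apply: nrm_cauchy_cvg => e e0.
  have [||N hN] := @expr_small _ (nrm x) (e / (c / (1 - nrm x))).
  - by rewrite x0.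
  - by rewrite !(divr_gt0, subr_gt0).
  have hN' m n : (N <= m)%N -> (m <= n)%N -> nrm (s n - s m) <= e.
    move=> Nm mn; rewrite (le_trans (sE _ _ mn)) // mulrC -ler_pdivlMr ?hN //.
    by rewrite divr_gt0 // subr_gt0.
  exists N => m n Nm Nn; case: (leqP m n) => [mn|/ltnW nm]; last exact: hN'.
  by rewrite -nrmN opprB hN'.
(* The limit l of the partial sums s n is a two-sided inverse: l (1 - x) - 1 is
   - (s n - l) (1 - x) - x ^+ n for all n, and both terms tend to 0. *)
have eps0 (z : A) : (forall e : R, 0 < e -> nrm z <= (1 + nrm (1 - x)) * e) -> z = 0.
  move=> hz; apply: nrm_eq0; apply/eqP; rewrite eq_le nrm_ge0 andbT.
  have d0 : 0 < 1 + nrm (1 - x) by rewrite ltr_pwDl // nrm_ge0.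
  apply/ler_addgt0Pl => e e0; rewrite addr0.
  have := hz _ (divr_gt0 e0 d0); by rewrite [leRHS]mulrC divfK ?gt_eqF.
have key (e : R) : 0 < e ->
    exists2 n, nrm (s n - l) <= e & nrm (x ^+ n) <= e.
  move=> e0; have [N hN] := hl _ e0.
  have [||M hM] := @expr_small _ (nrm x) (e / c); rewrite ?x0 ?divr_gt0 //.
  exists (maxn N M); rewrite ?hN ?leq_maxl // (le_trans (nrmX _ _)) //.
  by rewrite mulrC -ler_pdivlMr // hM // leq_maxr.
apply/unitrP; exists l; split; apply/eqP; rewrite -subr_eq0;
apply/eqP/eps0 => e /key [n n1 n2].
- have -> : l * (1 - x) - 1 = - ((s n - l) * (1 - x)) - x ^+ n.
    by rewrite mulrBl sr !opprB addrA addrAC addrK.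
  rewrite (le_trans (nrmB _ _)) // nrmN [leRHS]mulrDl mul1r [leRHS]addrC lerD //.
  by rewrite (le_trans (nrmM _ _)) // mulrC ler_wpM2l // nrm_ge0.
- have -> : (1 - x) * l - 1 = - ((1 - x) * (s n - l)) - x ^+ n.
    by rewrite mulrBr sl !opprB addrA addrAC addrK.
  rewrite (le_trans (nrmB _ _)) // nrmN [leRHS]mulrDl mul1r [leRHS]addrC lerD //.
  by rewrite (le_trans (nrmM _ _)) // ler_wpM2l // nrm_ge0.
Qed.

End BanachNorm.

(** * Uniformity on discs of the complex plane *)

Section Disc.
Variable R : realType.

Lemma nrm_complex (a b : R) : nrm (a +i* b) <= `|a| + `|b|.
Proof.
rewrite [X in nrm X]complexE /= (le_trans (nrmD _ _)) //.
by rewrite nrmCM nrm_i mul1r !nrm_real.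
Qed.

Lemma Re_le_nrm (l : R[i]) : `|complex.Re l| <= nrm l.
Proof. by rewrite -lecR -normr_nrm normc_ge_Re. Qed.

Lemma Im_le_nrm (l : R[i]) : `|complex.Im l| <= nrm l.
Proof.
have := Re_le_nrm (l * 'i); rewrite nrmCM nrm_i mulr1.
by case: l => a b /=; rewrite !mulr0 mulr1 sub0r normrN.
Qed.

(** Compactness of a disc: thresholds that exist locally can be chosen uniformly.
The disc is covered by a square, which lies in the disc of radius 2 r. *)
Lemma disc_uniform (r : R) (P : nat -> R[i] -> Prop) :
  (forall n m l, (n <= m)%N -> P n l -> P m l) ->
  (forall l, nrm l <= 2 * r -> exists2 d : R, 0 < d &
     exists n, forall m, nrm (m - l) < d -> P n m) ->
  exists n, forall l, nrm l <= r -> P n l.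
Proof.
move=> Pmono Ploc.
pose K : set (R * R) := `[-r, r] `*` `[-r, r].
have /compact_near_coveringP : compact K by apply: compact_setX; exact: segment_compact.
move=> /(_ nat \oo (fun n z => P n (z.1 +i* z.2))) [].
  move=> [a b] [/=]; rewrite !in_itv /= => ar br.
  have [|d d0 [n hn]] := Ploc (a +i* b).
    by rewrite (le_trans (nrm_complex _ _)) // mulr_natl mulr2n lerD // ler_norml.
  exists (ball (a, b) (d / 2), [set m | (n <= m)%N]).
    split => /=; last by exists n.
    by apply: nbhsx_ballx; rewrite divr_gt0.
  move=> [[u v] m] [/= [+ +] nm].
  rewrite -ball_normE /ball_ /= => au bv.
  apply: Pmono nm _; apply: hn.
  have -> : (u +i* v) - (a +i* b) = (u - a) +i* (v - b) by [].
  rewrite (le_lt_trans (nrm_complex _ _)) // [ltRHS]splitr.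
  by rewrite ltrD // distrC.
move=> n _ hn; exists n => l lr; case: l lr => a b abr.
apply: (hn n _ (a, b)) => //=.
split => /=; rewrite in_itv /= -ler_norml (le_trans _ abr) //.
  exact: (Re_le_nrm (a +i* b)).
exact: (Im_le_nrm (a +i* b)).
Qed.

End Disc.

(** * Roots of unity and the growth of the powers of a quasinilpotent element *)

Section RootsOfUnity.
Variable R : realType.

Lemma complex_prim_root n : (0 < n)%N ->
  exists w : R[i], n.-primitive_root w.
Proof.
move=> n0; have [rs rsE] := closed_field_poly_normal ('X^n - 1 : {poly R[i]}).
rewrite (monicP (monicXnsubC _ n0)) scale1r in rsE.
have rs_size : size rs = n.
  by apply: succn_inj; rewrite -(size_prod_XsubC rs id) -rsE size_XnsubC.
have rs_uniq : uniq rs.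
  rewrite -separable_prod_XsubC -rsE separable_Xn_sub_1 //.
  by rewrite pnatr_eq0 -lt0n.
have rs_unity : all n.-unity_root rs.
  by apply/allP => z zrs; rewrite /root_of_unity rsE root_prod_XsubC.
have /hasP[w _ wn] := has_prim_root n0 rs_unity rs_uniq (eq_leq (esym rs_size)).
by exists w.
Qed.

Lemma nrm_prim_root n (w : R[i]) : n.-primitive_root w -> nrm w = 1.
Proof.
move=> wn; apply/eqP; rewrite -(pexpr_eq1 (prim_order_gt0 wn) (nrm_ge0 w)).
by rewrite -nrmCX (prim_expr_order wn) nrmC1.
Qed.

Lemma sum_prim_root n (w : R[i]) m : n.-primitive_root w ->
  \sum_(j < n) (w ^+ m) ^+ j = if (n %| m)%N then n%:R else 0.
Proof.
move=> wn; rewrite (prim_order_dvd wn); case: eqP => [->|/eqP wm].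
  by under eq_bigr do rewrite expr1n; rewrite sumr_const card_ord.
apply: (mulfI (_ : w ^+ m - 1 != 0)); first by rewrite subr_eq0.
by rewrite -subrX1 exprAC (prim_expr_order wn) expr1n subrr mulr0.
Qed.

End RootsOfUnity.

(** C. E. Rickart's elementary proof that an element x with spectrum {0} has
spectral radius 0. The hypothesis is the invertibility of 1 - l x for all l. *)
Section Rickart.
Variables (R : realType) (A : banachAlgType R[i]) (x : A).
Hypothesis ux : forall l : R[i], 1 - l *: x \is a GRing.unit.

Let V (l : R[i]) : A := (1 - l *: x)^-1.

Lemma resolventB l m : V m - V l = (m - l) *: (V m * x * V l).
Proof.
have -> : (m - l) *: (V m * x * V l) =
    V m * ((1 - l *: x) - (1 - m *: x)) * V l.
  have -> : (1 - l *: x) - (1 - m *: x) = (m - l) *: x.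
    by rewrite opprB addrC subrKA scalerBl.
  by rewrite -scalerAr scalerAl.
by rewrite mulrBr mulVr // mulrBl mul1r -mulrA divrr // mulr1.
Qed.

Lemma nrm_resolventB l m :
  nrm (V m - V l) <= nrm (m - l) * (nrm (V m) * nrm x * nrm (V l)).
Proof.
rewrite resolventB nrmZ ler_wpM2l ?nrm_ge0 // (le_trans (nrmM _ _)) //.
by rewrite ler_wpM2r ?nrm_ge0 // nrmM.
Qed.

(** The resolvent identity bounds V by 2 ||V l|| near each l; the disc is covered
by finitely many such neighbourhoods. *)
Lemma resolvent_bounded r : exists M : R, forall l, nrm l <= r -> nrm (V l) <= M.
Proof.
have [n l m nm /le_trans->//||n hn] :=
  @disc_uniform R r (fun n l => nrm (V l) <= n%:R); last by exists n%:R.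
  by rewrite ler_nat.
move=> l _; pose C := 2 * (nrm x * nrm (V l) + 1).
have xV0 : 0 <= nrm x * nrm (V l) by rewrite mulr_ge0 ?nrm_ge0.
have C0 : 0 < C by rewrite /C; lra.
exists C^-1; first by rewrite invr_gt0.
exists (Num.bound (2 * nrm (V l))) => m ml.
have := archi_boundP (mulr_ge0 (ler0n R 2) (nrm_ge0 (V l))).
move=> /ltW/(le_trans _); apply.
have h := nrm_resolventB l m.
have {}h : nrm (V m - V l) <= 2^-1 * nrm (V m).
  apply: (le_trans h); rewrite -mulrA mulrCA mulrC ler_wpM2r ?nrm_ge0 //.
  apply: le_trans (ler_wpM2r xV0 (ltW ml)) _.
  by rewrite mulrC ler_pdivrMr // /C; lra.
have := nrmD (V m - V l) (V l); rewrite subrK; lra.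
Qed.

(** Averaging the geometric series of V over the points w^j s, for w a primitive
n-th root of unity, leaves only the constant term, so the mean S s is the inverse
of 1 - s^n x^n. The bounds on S are those of V, hence do not depend on n: this is
what allows the comparison of S at two radii for all n at once. *)
Lemma resolvent_average r M : (forall l, nrm l <= r -> nrm (V l) <= M) ->
  forall n, (0 < n)%N -> exists S : R -> A, forall s, 0 <= s <= r ->
  [/\ S s * (1 - s%:C ^+ n *: x ^+ n) = 1, nrm (S s) <= M &
      forall t, 0 <= t <= r ->
      nrm (S s - S t) <= `|s - t| * (M * nrm x * M)].
Proof.
move=> VM n n0; have [w wn] := complex_prim_root R n0.
have n0C : n%:R != 0 :> R[i] by rewrite pnatr_eq0 -lt0n.
have wj (j : nat) : nrm (w ^+ j) = 1 by rewrite nrmCX (nrm_prim_root wn) expr1n.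
have ws s (j : nat) : 0 <= s <= r -> nrm (w ^+ j * s%:C) <= r.
  by move=> /andP[s0 sr]; rewrite nrmCM wj mul1r nrm_real ger0_norm.
have avg (F : 'I_n -> A) C : (forall j, nrm (F j) <= C) ->
    nrm (n%:R^-1 *: \sum_(j < n) F j) <= C.
  move=> FC; rewrite nrmZ.
  rewrite nrmCV nrm_nat.
  rewrite ler_pdivrMl ?ltr0n // (le_trans (nrm_sum _ _)) //.
  apply: le_trans (ler_sum _ (fun j _ => FC j)) _.
  by rewrite sumr_const card_ord mulr_natl.
exists (fun s => n%:R^-1 *: \sum_(j < n) V (w ^+ j * s%:C)) => s sr.
split.
- rewrite -scalerAl mulr_suml.
  have key (j : 'I_n) : V (w ^+ j * s%:C) * (1 - s%:C ^+ n *: x ^+ n) =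
      \sum_(k < n) ((w ^+ k) ^+ j * s%:C ^+ k) *: x ^+ k.
    have -> : s%:C ^+ n *: x ^+ n = ((w ^+ j * s%:C) *: x) ^+ n.
      by rewrite exprZn exprMn exprAC (prim_expr_order wn) expr1n mul1r.
    rewrite -mul1B_geometric_sum mulrA mulVr // mul1r.
    by apply: eq_bigr => k _; rewrite exprZn exprMn exprAC.
  under eq_bigr do rewrite key.
  rewrite exchange_big /=.
  under eq_bigr do rewrite -scaler_suml -mulr_suml (sum_prim_root _ wn).
  case: n n0 n0C {wn ws avg key} => // n _ n0C.
  rewrite big_ord_recl /= !expr0 mulr1 big1 ?addr0.
    by rewrite scalerA mulVf // scale1r.
  move=> i _; rewrite gtnNdvd ?mul0r ?scale0r //=.
  by rewrite /bump /= add1n ltnS.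
- by apply: avg => j; exact: VM (ws _ _ sr).
- move=> t tr; rewrite -scalerBr -sumrB; apply: avg => j.
  apply: le_trans (nrm_resolventB _ _) _.
  rewrite -mulrBr nrmCM wj mul1r -rmorphB nrm_real /= ler_wpM2l //.
  have hs := VM _ (ws _ j sr); have ht := VM _ (ws _ j tr).
  by rewrite !ler_pM ?mulr_ge0 ?nrm_ge0.
Qed.

Let vanishing (t : R) := forall e : R, 0 < e ->
  exists N, forall n, (N <= n)%N -> t ^+ n * nrm (x ^+ n) <= e.

(** If t^n ||x^n|| tends to 0, then S t tends to 1; by the Lipschitz bound S s
stays within 1/2 of 1 at s = t + 2 d, so its inverse 1 - s^n x^n is bounded in n,
and a geometric factor gives convergence to 0 at t + d < s. The length d of the
step depends only on the bound of the resolvent on the disc of radius r. *)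
Lemma powers_vanish_step r M t d :
  (forall l, nrm l <= r -> nrm (V l) <= M) ->
  0 <= t -> 0 < d -> t + 2 * d <= r -> d * (M * nrm x * M) <= 8^-1 ->
  vanishing t -> vanishing (t + d).
Proof.
move=> VM t0 d0 tdr dL vt.
have M0 : 0 <= M by apply: le_trans (VM 0 _); rewrite ?nrm_ge0 // nrm0; lra.
pose c := nrm (1 : A); have c0 : 0 <= c := nrm_ge0 _.
pose s := t + 2 * d.
have sbounded : exists N, forall n, (N <= n)%N -> s ^+ n * nrm (x ^+ n) <= 3 * c.
  have [|N hN] := vt (4 * (M + 1))^-1; first by rewrite invr_gt0; lra.
  exists (maxn N 1) => n; rewrite geq_max => /andP[Nn n0].
  have [S hS] := resolvent_average VM n0.
  have [|St_eq St_le _] := hS t; first by rewrite t0; lra.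
  have [|Ss_eq _ Ss_lip] := hS s; first by rewrite /s; lra.
  have St1 : nrm (S t - 1) <= 4^-1.
    have -> : S t - 1 = S t * (t%:C ^+ n *: x ^+ n).
      by rewrite -{1}St_eq mulrBr mulr1 opprB addrC subrK.
    rewrite (le_trans (nrmM _ _)) //.
    rewrite nrmZ nrmCX nrm_real ger0_norm //.
    have := hN n Nn; set y := _ * nrm (x ^+ n) => hy.
    have y0 : 0 <= y by rewrite mulr_ge0 ?exprn_ge0 ?nrm_ge0.
    apply: le_trans (ler_pM (nrm_ge0 _) y0 St_le hy) _.
    by rewrite ler_pdivrMr; lra.
  have Ss1 : nrm (S s - 1) <= 2^-1.
    have -> : S s - 1 = (S s - S t) + (S t - 1) by rewrite addrA subrK.
    apply: le_trans (nrmD _ _) _.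
    have := Ss_lip t; rewrite t0 /= => /(_ ltac:(lra)).
    have -> : `|s - t| = 2 * d by rewrite /s addrAC subrr add0r ger0_norm; lra.
    rewrite -mulrA; lra.
  set w := 1 - _ in Ss_eq.
  have wE : w = 1 - (S s - 1) * w by rewrite mulrBl mul1r Ss_eq opprB addrC subrK.
  have wle : nrm w <= 2 * c.
    have := nrmB (1 : A) ((S s - 1) * w); rewrite -wE -/c.
    have := nrmM (S s - 1) w.
    have := ler_wpM2r (nrm_ge0 w) Ss1.
    lra.
  have s0 : 0 <= s by rewrite /s; lra.
  have -> : s ^+ n * nrm (x ^+ n) = nrm (1 - w).
    by rewrite /w opprB addrC subrK nrmZ nrmCX nrm_real ger0_norm.
  by have := nrmB (1 : A) w; rewrite -/c; lra.
move=> e e0; have [N hN] := sbounded.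
have s0 : 0 < s by rewrite /s; lra.
have [||N' hN'] := @expr_small _ ((t + d) / s) (e / (3 * c + 1)).
- rewrite divr_ge0 ?(ltW s0) //=; last lra.
  by rewrite ltr_pdivrMr // mul1r /s; lra.
- by rewrite divr_gt0 //; lra.
exists (maxn N N') => n; rewrite geq_max => /andP[/hN h1 /hN' h2].
have -> : (t + d) ^+ n * nrm (x ^+ n) =
    ((t + d) / s) ^+ n * (s ^+ n * nrm (x ^+ n)).
  by rewrite mulrA -exprMn divfK // gt_eqF.
have y0 : 0 <= s ^+ n * nrm (x ^+ n).
  by rewrite mulr_ge0 ?exprn_ge0 ?nrm_ge0 ?(ltW s0).
apply: le_trans (ler_wpM2r y0 h2) _.
rewrite mulrAC ler_pdivrMr; last lra.
by rewrite ler_pM2l //; lra.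
Qed.

(** Finitely many steps of a fixed length lead from 0 to t. *)
Lemma quasinilpotent_powers (t e : R) : 0 <= t -> 0 < e ->
  exists N, forall n, (N <= n)%N -> t ^+ n * nrm (x ^+ n) <= e.
Proof.
move=> t0; move: e; rewrite -/(vanishing t).
have [M VM] := resolvent_bounded (3 * t).
set L := M * nrm x * M.
have M0 : 0 <= M by apply: le_trans (VM 0 _); rewrite ?nrm_ge0 // nrm0; lra.
have L0 : 0 <= L by rewrite !mulr_ge0 ?nrm_ge0.
have v0 : vanishing 0.
  move=> e e0; exists 1%N => n n1; rewrite expr0n.
  by rewrite gtn_eqF // mul0r ltW.
have [->//|tn0] := eqVneq t 0.
have {}t0 : 0 < t by rewrite lt_neqAle eq_sym tn0.
have tL : 0 <= 8 * (t * L) by rewrite mulr_ge0 ?ler0n // mulr_ge0 // ltW.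
pose m := (Num.bound (8 * (t * L))).+1.
have m0 : 0 < m%:R :> R by rewrite ltr0n.
pose d := t / m%:R; have d0 : 0 < d by rewrite divr_gt0.
have dm : m%:R * d = t by rewrite /d mulrC divfK ?gt_eqF.
suff vk k : (k <= m)%N -> vanishing (k%:R * d).
  by rewrite -dm; exact: vk.
elim: k => [|k IHk] km; first by rewrite mul0r.
rewrite -addn1 natrD mulrDl mul1r; apply: (powers_vanish_step VM) => //.
- by rewrite mulr_ge0 // ltW.
- have : (k.+1)%:R * d <= m%:R * d by rewrite ler_pM2r // ler_nat.
  have : 1 * d <= m%:R * d by rewrite ler_pM2r // ler1n.
  rewrite dm -addn1 natrD mulrDl; lra.
- rewrite -/L -(ler_pM2l m0) mulrA dm.
  have : 8 * (t * L) <= m%:R.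
    by rewrite (le_trans (ltW (archi_boundP tL))) // ler_nat.
  lra.
- by apply: IHk; exact: ltnW.
Qed.

End Rickart.

(** * Polynomial families of quasinilpotent elements *)

(** Polynomial functions of a complex parameter with values in A are encoded as
polynomials over A evaluated at the central elements l%:A. *)
Section PolynomialFamilies.
Variables (R : realType) (A : banachAlgType R[i]).
Implicit Types (P Q : {poly A}) (l m : R[i]) (r e : R).

Lemma comm_poly_scalar P l : comm_poly P l%:A.
Proof.
by apply: comm_coef_poly => i; rewrite -scalerAl -scalerAr mul1r mulr1.
Qed.

Lemma horner_scalarM P Q l : (P * Q).[l%:A] = P.[l%:A] * Q.[l%:A].
Proof. exact/hornerM_comm/comm_poly_scalar. Qed.

Lemma horner_scalarXn P l n : (P ^+ n).[l%:A] = P.[l%:A] ^+ n.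
Proof. exact/horner_exp_comm/comm_poly_scalar. Qed.

Lemma horner_scalar_sum P l n : (size P <= n)%N ->
  P.[l%:A] = \sum_(i < n) l ^+ i *: P`_i.
Proof.
move=> Pn; rewrite (horner_coef_wide _ Pn); apply: eq_bigr => i _.
by rewrite exprZn expr1n -scalerAr mulr1.
Qed.

Lemma horner_scalar_lipschitz P l : exists2 C : R, 0 <= C &
  forall m, nrm (m - l) <= 1 ->
    nrm (P.[m%:A] - P.[l%:A]) <= C * nrm (m - l).
Proof.
elim/poly_ind: P => [|P c [C C0 hC]].
  by exists 0 => // m _; rewrite !horner0 subrr nrm0 mul0r.
have N0 := nrm_ge0 P.[l%:A]; have l0 := nrm_ge0 l.
exists ((nrm l + 1) * C + nrm P.[l%:A]); first by rewrite addr_ge0 ?mulr_ge0 //; lra.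
move=> m ml; have {}hC := hC m ml.
have d0 := nrm_ge0 (m - l).
rewrite !hornerMXaddC opprD addrACA subrr addr0.
rewrite -!scalerAr !mulr1.
have -> : m *: P.[m%:A] - l *: P.[l%:A] =
    m *: (P.[m%:A] - P.[l%:A]) + (m - l) *: P.[l%:A].
  by rewrite scalerBr scalerBl addrA subrK.
apply: le_trans (nrmD _ _) _; rewrite !nrmZ [leRHS]mulrDl lerD //; last first.
  by rewrite mulrC.
rewrite -mulrA ler_pM ?nrm_ge0 //.
by have := nrmD (m - l) l; rewrite subrK; lra.
Qed.

(** The k-th coefficient is a mean of values of P on the circle of radius r,
weighted by powers of a root of unity whose order exceeds the degree. *)
Lemma cauchy_estimate P r B k : 0 <= r ->
  (forall l, nrm l <= r -> nrm P.[l%:A] <= B) -> r ^+ k * nrm P`_k <= B.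
Proof.
move=> r0 PB; have B0 : 0 <= B.
  by apply: le_trans (nrm_ge0 _) (PB 0 _); rewrite nrm0.
case: (ltnP k (size P)) => [kP|Pk]; last by rewrite nth_default // nrm0 mulr0.
set n := size P in kP; have n0 : (0 < n)%N by apply: leq_ltn_trans kP.
have [w wn] := complex_prim_root R n0.
have wj (j : nat) : nrm (w ^+ j) = 1 by rewrite nrmCX (nrm_prim_root wn) expr1n.
have avg : \sum_(j < n) (w ^+ (n - k)) ^+ j *: P.[(w ^+ j * r%:C)%:A] =
    (n%:R * r%:C ^+ k) *: P`_k.
  under eq_bigr do rewrite (horner_scalar_sum _ (leqnn _)) scaler_sumr.
  rewrite exchange_big /= (bigD1 (Ordinal kP)) //= [X in _ + X]big1 ?addr0.
    under eq_bigr => j _.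
      rewrite scalerA exprMn mulrA [w ^+ j ^+ k]exprAC -exprMn -exprD.
      rewrite subnK ?(ltnW kP) // (prim_expr_order wn) expr1n mul1r.
      over.
    by rewrite sumr_const card_ord scalerMnl mulr_natl.
  move=> i ik.
  under eq_bigr => j _.
    rewrite scalerA exprMn mulrA [w ^+ j ^+ i]exprAC -exprMn -exprD.
    over.
  rewrite -scaler_suml -mulr_suml (sum_prim_root _ wn).
  case: ifP => [nd|_]; last by rewrite mul0r scale0r.
  case/negP: ik; apply/eqP/val_inj => /=.
  have := ltn_ord i; rewrite -/n => lin; move: nd.
  case: (ltngtP i k) => // ik.
  - rewrite gtnNdvd ?addn_gt0 ?subn_gt0 ?kP //.
    by rewrite -[ltnRHS](subnK (ltnW kP)) ltn_add2l.
  - rewrite -(subnKC (ltnW ik)) addnA subnK ?(ltnW kP) //.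
    rewrite dvdn_addr // gtnNdvd ?subn_gt0 //.
    by rewrite (leq_ltn_trans (leq_subr _ _)).
have : nrm ((n%:R * r%:C ^+ k) *: P`_k) <= n%:R * B.
  rewrite -avg (le_trans (nrm_sum _ _)) //.
  apply: le_trans (_ : \sum_(j < n) B <= _).
    apply: ler_sum => j _; rewrite nrmZ exprAC nrmCX wj expr1n mul1r.
    by apply: PB; rewrite nrmCM wj mul1r nrm_real ger0_norm.
  by rewrite sumr_const card_ord mulr_natl.
rewrite nrmZ nrmCM nrm_nat nrmCX nrm_real ger0_norm // -mulrA.
by rewrite ler_pM2l // ltr0n.
Qed.

Lemma unit_1subX (x : A) n : 1 - x ^+ n \is a GRing.unit -> 1 - x \is a GRing.unit.
Proof.
rewrite -mul1B_geometric_sum unitrM_comm; first by case/andP.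
apply: commr_sum => i _.
by apply: commrX; apply/commr_sym/commrB; [apply: commr1|].
Qed.

(** Let F be the function defined by P. For |l| <= r the sequence
||F(l)^(2^k)||^(1/2^k) decreases to 0, so by Dini's argument ||F^n|| is at most e^n
on a smaller disc for some n = 2^k. Cauchy's estimates for the polynomial F^n, whose
degree is at most d n, then bound ||F(l0)^n|| by (d n + 1) e^n K^(d n), which is
less than 1 for e small with respect to K and d. *)
Lemma quasinilpotent_extension P r : 0 < r ->
  (forall l, nrm l <= r -> forall m, 1 - m *: P.[l%:A] \is a GRing.unit) ->
  forall l, 1 - P.[l%:A] \is a GRing.unit.
Proof.
move=> r0 Pqn l0.
have [d Pd] : exists d, (size P).-1 = d by exists (size P).-1.
pose s := r / 2; have s0 : 0 < s by rewrite divr_gt0.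
have l00 := nrm_ge0 l0.
(* As K is at least 1 and at least |l0| / s, the power K^(d n) dominates
   (|l0| / s)^i for all i <= d n. *)
pose K := 1 + nrm l0 / s.
have K1 : 1 <= K by rewrite lerDl divr_ge0 // ltW.
have Kd0 : 0 < (2 * K) ^+ d by rewrite exprn_gt0 // mulr_gt0 // (lt_le_trans ltr01 K1).
(* In the base 2 K the factor 2 absorbs d n + 1 <= 2^(d n); the remaining factor
   2 leaves 2^-n < 1. *)
pose e := (2 * (2 * K) ^+ d)^-1; have e0 : 0 < e by rewrite invr_gt0 mulr_gt0.
have [n m l nm hn|l lr|k hk] := @disc_uniform R s
  (fun k l => nrm (P.[l%:A] ^+ (2 ^ k)) <= e ^+ (2 ^ k)).
- rewrite -(subnKC nm) expnD exprM exprM.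
  have : (0 < 2 ^ (m - n))%N by rewrite expn_gt0.
  case: (2 ^ (m - n))%N => // p _; apply: le_trans (nrmXS _ _) _.
  by rewrite lerXn2r // nnegrE ?nrm_ge0 // exprn_ge0 // ltW.
- rewrite /s mulrC divfK ?pnatr_eq0 // in lr.
  have [||N hN] := @quasinilpotent_powers _ _ _ (Pqn l lr) e^-1 2^-1.
  + by rewrite invr_ge0 ltW.
  + by rewrite invr_gt0.
  have {hN} := hN (2 ^ N)%N (ltnW (ltn_expl N (ltnSn 1))); rewrite exprVn.
  set q := (2 ^ N)%N => hN.
  have eq0 : 0 < e ^+ q by rewrite exprn_gt0.
  rewrite mulrC ler_pdivrMr // in hN.
  have [C C0 hC] := horner_scalar_lipschitz (P ^+ q) l.
  exists (Num.min 1 (e ^+ q / (2 * (C + 1)))).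
    by rewrite lt_min ltr01 divr_gt0 // mulr_gt0 //; lra.
  exists N => m; rewrite lt_min => /andP[m1 m2].
  have {hC} := hC m (ltW m1); rewrite !horner_scalarXn -/q => hC.
  have {}m2 : C * nrm (m - l) <= e ^+ q / 2.
    have := nrm_ge0 (m - l); rewrite ltr_pdivlMr in m2; last lra.
    nra.
  have := nrmD (P.[m%:A] ^+ q - P.[l%:A] ^+ q) (P.[l%:A] ^+ q).
  by rewrite subrK; lra.
pose n := (2 ^ k)%N; have n0 : (0 < n)%N by rewrite expn_gt0.
apply: (@unit_1subX _ n); apply: neumann; rewrite -horner_scalarXn.
have Pn : (size (P ^+ n) <= (d * n).+1)%N by rewrite -Pd; apply: size_poly_exp_leq.
rewrite (horner_scalar_sum _ Pn).
have term (i : 'I_(d * n).+1) :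
    nrm (l0 ^+ i *: (P ^+ n)`_i) <= e ^+ n * K ^+ (d * n).
  have hi : s ^+ i * nrm (P ^+ n)`_i <= e ^+ n.
    apply: cauchy_estimate (ltW s0) _ => l ls.
    by rewrite horner_scalarXn; exact: hk.
  rewrite nrmZ nrmCX.
  have -> : nrm l0 ^+ i * nrm (P ^+ n)`_i =
      (nrm l0 / s) ^+ i * (s ^+ i * nrm (P ^+ n)`_i).
    by rewrite mulrA -exprMn divfK // gt_eqF.
  have h0 : 0 <= nrm l0 / s by rewrite divr_ge0 // ltW.
  rewrite mulrC ler_pM ?mulr_ge0 ?exprn_ge0 ?nrm_ge0 ?(ltW s0) //.
  apply: le_trans (_ : K ^+ i <= _).
    by rewrite lerXn2r ?nnegrE // /K; lra.
  by rewrite ler_weXn2l // -ltnS.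
apply: le_lt_trans (nrm_sum _ _) _.
apply: le_lt_trans (ler_sum _ (fun i _ => term i)) _.
rewrite sumr_const card_ord -mulr_natl.
have dn2 : (d * n).+1%:R <= 2 ^+ (d * n) :> R by rewrite -natrX ler_nat ltn_expl.
have eK0 : 0 < e ^+ n * K ^+ (d * n)
  by rewrite mulr_gt0 ?exprn_gt0 // (lt_le_trans ltr01 K1).
apply: le_lt_trans (ler_wpM2r (ltW eK0) dn2) _.
have -> : 2 ^+ (d * n) * (e ^+ n * K ^+ (d * n)) = 2^-1 ^+ n :> R.
  rewrite mulrCA -exprMn [_ ^+ (d * n)]exprM -exprMn; congr (_ ^+ _).
  by rewrite /e invfM mulfVK ?gt_eqF.
by rewrite exprn_ilt1 ?invr_ge0 ?invf_lt1 ?ltr1n // -lt0n.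
Qed.
End PolynomialFamilies.

(** * Minimal left ideals and the socle of a semisimple ring *)

Section Ring.
Variable A : unitRingType.
Implicit Types (x y c p : A) (L J : set A).

(** Jacobson's lemma: 1 + y (1 - x y)^-1 x inverts 1 - y x. *)
Lemma unit_1subM_swap x y :
  1 - x * y \is a GRing.unit -> 1 - y * x \is a GRing.unit.
Proof.
move=> /unitrP[u [u1 u2]]; apply/unitrP; exists (1 + y * u * x); split.
- have -> : (1 + y * u * x) * (1 - y * x) =
      1 - y * x + y * (u * (1 - x * y)) * x.
    by rewrite mulrDl mul1r !(mulrBr, mulrBl) !mulr1 !mulrA.
  by rewrite u1 mulr1 subrK.
- have -> : (1 - y * x) * (1 + y * u * x) =
      1 - y * x + y * ((1 - x * y) * u) * x.
    by rewrite mulrDr mulr1 !(mulrBr, mulrBl) !mul1r !mulrA.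
  by rewrite u2 mulr1 subrK.
Qed.

Lemma left_idealN L x : left_ideal L -> L x -> L (- x).
Proof. by case=> _ _ LM Lx; rewrite -mulN1r; exact: LM. Qed.

Hypothesis ssA : semisimple A.

(** If c lies outside a maximal left ideal M, then M + A c contains 1, so that
1 - y c is in M for some y and cannot be a unit. *)
Lemma semisimple_eq0 c : (forall y, 1 - y * c \is a GRing.unit) -> c = 0.
Proof.
move=> uc; suff : jacobson_radical c by rewrite ssA.
move=> M [[M0 MD MM] MT Mmax]; apply: contrapT => Mc; apply: MT.
pose L := [set x | exists m y, M m /\ x = m + y * c].
have LI : left_ideal L.
  split.
  - by exists 0, 0; rewrite mul0r addr0.
  - move=> _ _ [m [y [Mm ->]]] [m' [y' [Mm' ->]]].
    by exists (m + m'), (y + y'); rewrite addrACA mulrDl; split=> //; exact: MD.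
  - move=> a _ [m [y [Mm ->]]]; exists (a * m), (a * y).
    by rewrite mulrDr mulrA; split=> //; exact: MM.
have ML : M `<=` L by move=> m Mm; exists m, 0; rewrite mul0r addr0.
case: (Mmax _ LI ML) => LE.
  by case: Mc; rewrite -LE; exists 0, 1; rewrite mul1r add0r.
have : L 1 by rewrite LE.
move=> [m [y [Mm E]]]; have mE : m = 1 - y * c by rewrite E addrK.
apply/seteqP; split=> // z _; rewrite -(mulrVK (uc y) z) -mE.
exact: MM.
Qed.

(** The products y c have square 0. *)
Lemma semisimple_semiprime c : (forall y, c * y * c = 0) -> c = 0.
Proof.
move=> cc; apply: semisimple_eq0 => y; apply/unitrP; exists (1 + y * c).
have yc2 : y * c * (y * c) = 0 by rewrite -mulrA [c * _]mulrA cc mulr0.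
split; first by rewrite mulrDl mul1r mulrBr mulr1 yc2 subr0 subrK.
by rewrite mulrDr mulr1 mulrBl mul1r yc2 subr0 subrK.
Qed.

Lemma minimal_left_ideal_eq L J x : minimal_left_ideal L -> left_ideal J ->
  J `<=` L -> J x -> x <> 0 -> J = L.
Proof.
by move=> [_ _ Lmin] JI JL Jx x0; case: (Lmin _ JI JL) => // JE; rewrite JE in Jx.
Qed.

Lemma left_ideal_mulr L c : left_ideal L -> left_ideal [set x * c | x in L].
Proof.
move=> [L0 LD LM]; split.
- by exists 0; rewrite ?mul0r.
- by move=> _ _ [x Lx <-] [y Ly <-]; exists (x + y); [exact: LD|rewrite mulrDl].
- by move=> a _ [x Lx <-]; exists (a * x); [exact: LM|rewrite mulrA].
Qed.

(** Brauer's lemma. Since L is not nilpotent, L l = L for some l in L, and l has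
trivial left annihilator in L. The element p of L with p l = l is then an idempotent
generating L. A nonzero element t of pAp generates L = A t as well, hence has a
left inverse in pAp. *)
Lemma minimal_left_ideal_idempotent L : minimal_left_ideal L ->
  exists p, [/\ p <> 0, p * p = p, L = [set x | x * p = x] &
    forall z, p * z * p <> 0 -> exists2 w, w * (p * z * p) = p & p * w * p = w].
Proof.
move=> Lm; have [LI Lnz _] := Lm; have [L0 LD LM] := LI.
have [l Ll [x Lx xl]] : exists2 l, L l & exists2 x, L x & x * l <> 0.
  apply: contrapT => nex; apply: Lnz; apply/seteqP; split=> [c Lc|_ -> //].
  apply: semisimple_semiprime => y; rewrite -mulrA; apply: contrapT => h.
  by apply: nex; exists (y * c); [exact: LM|exists c].
have LlE : [set x * l | x in L] = L.
  apply: minimal_left_ideal_eq Lm (left_ideal_mulr _ LI) _ _ xl.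
    by move=> _ [y Ly <-]; exact: LM.
  by exists x.
have [p Lp pl] : [set x * l | x in L] l by rewrite LlE.
have annL y : L y -> y * l = 0 -> y = 0.
  move=> Ly yl; apply: contrapT => y0.
  have E : [set y | L y /\ y * l = 0] = L.
    apply: (@minimal_left_ideal_eq _ _ y) => //; last by move=> z [].
    split; first by split; rewrite ?mul0r.
    - by move=> a b [La al] [Lb bl]; split; [exact: LD|rewrite mulrDl al bl addr0].
    - by move=> a b [Lb bl]; split; [exact: LM|rewrite -mulrA bl mulr0].
  by apply: xl; have : L x := Lx; rewrite -{1}E => -[].
have LP y : L y -> y * p = y.
  move=> Ly; apply/eqP; rewrite -subr_eq0; apply/eqP/annL.
    by apply: LD; [exact: LM|exact: left_idealN].
  by rewrite mulrBl -mulrA pl subrr.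
have p0 : p <> 0.
  by move=> p0; apply: xl; rewrite -pl p0 !(mul0r, mulr0).
have pp : p * p = p by exact: LP.
exists p; split=> //.
  by apply/seteqP; split=> y /=; [exact: LP|move=> <-; exact: LM].
move=> z z0; set t := p * z * p in z0 *.
have tp : t * p = t by rewrite /t -!mulrA pp.
have pt : p * t = t by rewrite /t !mulrA pp.
have Lt : L t by rewrite -tp; exact: LM.
have AtE : [set y * t | y in setT] = L.
  apply: minimal_left_ideal_eq Lm _ _ _ z0.
  - by apply: left_ideal_mulr; split.
  - by move=> _ [y _ <-]; exact: LM.
  - by exists 1; rewrite ?mul1r.
have [y _ yt] : [set y * t | y in setT] p by rewrite AtE.
exists (p * y * p); first by rewrite -!mulrA pt yt LP.
by rewrite -!mulrA pp !mulrA pp.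
Qed.

(** Right multiplication by c maps L onto L c, and the preimage in L of a left
ideal is a left ideal. *)
Lemma minimal_left_ideal_mulr L c : minimal_left_ideal L ->
  (exists2 x, L x & x * c <> 0) -> minimal_left_ideal [set x * c | x in L].
Proof.
move=> Lm [x Lx xc]; have [LI _ _] := Lm; have [L0 LD LM] := LI.
split; first exact: left_ideal_mulr.
  move=> E; apply: xc. have : [set y * c | y in L] (x * c) by exists x.
  by rewrite E.
move=> J [J0 JD JM] JL.
have [[y Ly [Jy yc]]|nex] := pselect (exists2 y, L y & J (y * c) /\ y * c <> 0).
  right; apply/seteqP; split=> // _ [z Lz <-].
  have E : [set y | L y /\ J (y * c)] = L.
    apply: (@minimal_left_ideal_eq _ _ y) => //; last 2 first.
    - by move=> u [].
    - by move=> y0; apply: yc; rewrite y0 mul0r.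
    split; first by rewrite /= mul0r.
    - by move=> a b [La Ja] [Lb Jb]; split; [exact: LD|rewrite mulrDl; exact: JD].
    - by move=> a b [Lb Jb]; split; [exact: LM|rewrite -mulrA; exact: JM].
  by move: Lz; rewrite -{1}E => -[].
left; apply/seteqP; split=> [z Jz|_ -> //].
apply: contrapT => z0; apply: nex.
by have [y Ly yz] := JL _ Jz; exists y; rewrite ?yz.
Qed.

Lemma minimal_left_ideal_sub_socle L : minimal_left_ideal L -> L `<=` socle A.
Proof.
move=> Lm x Lx; exists 1%N, (fun=> x); split; first by move=> _; exists L.
by rewrite big_ord1.
Qed.

Lemma socleD x y : socle A x -> socle A y -> socle A (x + y).
Proof.
move=> [n [u [uL ->]]] [m [v [vL ->]]].
exists (n + m)%N, (fun i => match fintype.split i with inl i => u i | inr i => v i end).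
split; first by move=> i; case: (fintype.split i).
rewrite big_split_ord /=; congr (_ + _); apply: eq_bigr => i _.
  by rewrite -[lshift _ _]/(unsplit (inl _ i)) unsplitK.
by rewrite -[rshift _ _]/(unsplit (inr _ i)) unsplitK.
Qed.

Lemma socle0 : socle A 0.
Proof. by exists 0%N, (fun=> 0); split; [case|rewrite big_ord0]. Qed.

Lemma socle_ind (P : A -> Prop) : P 0 ->
  (forall x y, P x -> P y -> P (x + y)) ->
  (forall L, minimal_left_ideal L -> L `<=` P) -> socle A `<=` P.
Proof.
move=> P0 PD PL _ [n [x [xL ->]]]; elim/big_ind: _ => // i _.
by have [L Lm] := xL i; exact: PL.
Qed.

Lemma socle_two_sided : two_sided_ideal (socle A).
Proof.
split; first split.
- exact: socle0.
- exact: socleD.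
- move=> a; apply: (@socle_ind (fun x => socle A (a * x))).
  + by rewrite mulr0; exact: socle0.
  + by move=> x y ax ay; rewrite mulrDr; exact: socleD.
  + move=> L Lm x Lx; apply: (minimal_left_ideal_sub_socle Lm).
    by case: Lm => -[_ _ LM] _ _; exact: LM.
- move=> x a; move: x; apply: (@socle_ind (fun x => socle A (x * a))).
  + by rewrite mul0r; exact: socle0.
  + by move=> x y ax ay; rewrite mulrDl; exact: socleD.
  + move=> L Lm x Lx; have [->|/eqP xa] := eqVneq (x * a) 0; first exact: socle0.
    apply: (@minimal_left_ideal_sub_socle [set x * a | x in L]); last by exists x.
    by apply: minimal_left_ideal_mulr => //; exists x.
Qed.

Lemma socle_minimal_left_ideal b : socle A b -> b <> 0 ->
  exists L, minimal_left_ideal L.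
Proof.
move=> + b0; apply: contraPP => nex [n [x [xL E]]]; apply: b0.
rewrite E big1 // => i _; have [L Lm _] := xL i.
by case: nex; exists L.
Qed.

Lemma minimal_left_ideal_setI J L : left_ideal J -> minimal_left_ideal L ->
  ~ (L `<=` J) -> forall x, J x -> L x -> x = 0.
Proof.
move=> [J0 JD JM] Lm LJ x Jx Lx; apply: contrapT => x0; apply: LJ.
have [[L0 LD LM] _ _] := Lm.
have <- : J `&` L = L; last by move=> ? [].
apply: (@minimal_left_ideal_eq _ _ x) => //.
split; first by split.
- by move=> a b [Ja La] [Jb Lb]; split; [exact: JD|exact: LD].
- by move=> a b [Jb Lb]; split; [exact: JM|exact: LM].
Qed.

(** Otherwise J meets every minimal left ideal in 0, so J annihilates the socle.
The socle contains J, whence J^2 = 0. *)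
Lemma two_sided_ideal_minimal_left_ideal J : two_sided_ideal J ->
  J `<=` socle A -> J <> [set 0] -> exists2 L, minimal_left_ideal L & L `<=` J.
Proof.
move=> [JI JMr] JS Jnz; have [J0 _ JM] := JI.
apply: contrapT => nex; apply: Jnz; apply/seteqP; split=> [c Jc|_ -> //].
apply: semisimple_semiprime => y.
suff : socle A `<=` [set s | forall z, J z -> z * s = 0].
  by move=> /(_ _ (JS _ Jc)); apply; exact: JMr.
apply: socle_ind.
- by move=> z _; rewrite mulr0.
- by move=> s t hs ht z Jz; rewrite mulrDr hs // ht // addr0.
- move=> L Lm s Ls z Jz.
  apply: (minimal_left_ideal_setI JI Lm) => [LJ||]; last 2 first.
  + exact: JMr.
  + by case: Lm => -[_ _ LM] _ _; exact: LM.
  by apply: nex; exists L.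
Qed.

End Ring.

(** * Gelfand-Mazur corners and the spectrum of finite rank elements *)

Section GelfandMazur.
Variables (R : realType) (A : banachAlgType R[i]).
Implicit Types (p x y z : A).

(** Gelfand-Mazur in the division algebra pAp. If y = p z p were not a scalar
multiple of p, then p - l y would be invertible in pAp, and 1 - l y in A, for all
l, so that ||v||^n ||y^n|| would tend to 0 for every v. Taking for v the inverse
of y in pAp contradicts v^n p y^n = p. *)
Lemma corner_scalar p : p <> 0 -> p * p = p ->
  (forall z, p * z * p <> 0 -> exists2 w, w * (p * z * p) = p & p * w * p = w) ->
  forall z, exists k : R[i], p * z * p = k *: p.
Proof.
move=> p0 pp pdiv z; apply: contrapT => nex.
pose y := p * z * p.
have py : p * y = y by rewrite /y !mulrA pp.
have yp : y * p = y by rewrite /y -!mulrA pp.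
have yk k : y <> k *: p by move=> yk; apply: nex; exists k.
have u l : 1 - l *: y \is a GRing.unit.
  have tE : p - l *: y = p * (1 - l *: z) * p.
    by rewrite mulrBr mulr1 mulrBl pp -scalerAr -scalerAl.
  have t0 : p * (1 - l *: z) * p <> 0.
    rewrite -tE => E; have [l0|/eqP l0] := eqVneq l 0.
      by apply: p0; move: E; rewrite l0 scale0r subr0.
    apply: (yk l^-1); move/eqP: E; rewrite subr_eq0 => /eqP ->.
    by rewrite scalerA mulVf ?scale1r //; exact/eqP.
  have [w wl wp] := pdiv _ t0; rewrite -tE in wl.
  have w0 : p * w * p <> 0.
    by rewrite wp => w0; apply: p0; rewrite -wl w0 mul0r.
  have [v vl vp] := pdiv _ w0; rewrite wp in vl.
  have pw : p * w = w by rewrite -wp !mulrA pp.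
  have {}wp : w * p = w by rewrite -wp -!mulrA pp.
  have pt : p * (p - l *: y) = p - l *: y by rewrite mulrBr pp -scalerAr py.
  have vpE : v * p = v by rewrite -vp -!mulrA pp.
  have tv : p - l *: y = v by rewrite -pt -[p in p * _]vl -mulrA wl.
  have wr : (p - l *: y) * w = p by rewrite tv.
  apply/unitrP; exists (1 - p + w); split.
  - have -> : (1 - p + w) * (1 - l *: y) = 1 - p + w * (1 - l *: y).
      by rewrite mulrDl mulrBr mulr1 mulrBl mul1r -scalerAr py subrr subr0.
    have -> : w * (1 - l *: y) = w * (p - l *: y).
      by rewrite !mulrBr mulr1 wp.
    by rewrite wl subrK.
  - have -> : (1 - l *: y) * (1 - p + w) = 1 - p + (1 - l *: y) * w.
      by rewrite mulrDr mulrBl mul1r mulrBr mulr1 -scalerAl yp subrr subr0.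
    have -> : (1 - l *: y) * w = (p - l *: y) * w.
      by rewrite !mulrBl mul1r pw.
    by rewrite wr subrK.
have y0 : p * z * p <> 0 by rewrite -/y => y0; apply: (yk 0); rewrite scale0r.
have [v vy vp] := pdiv _ y0.
rewrite -/y in vy.
have vpy n : v ^+ n * p * y ^+ n = p.
  elim: n => [|n IHn]; first by rewrite !expr0 mul1r mulr1.
  by rewrite exprSr exprS mulrA -[_ * v * p]mulrA -[_ * y]mulrA -[v * p * y]mulrA py vy.
have [N hN] := quasinilpotent_powers u (nrm_ge0 v) (ltac:(lra) : 0 < 2^-1 :> R).
have {hN} := hN N.+1 (leqnSn N) => hN.
apply: p0; apply: nrm_eq0; apply/eqP; rewrite eq_le nrm_ge0 andbT.
have h : nrm p <= nrm v ^+ N.+1 * nrm p * nrm (y ^+ N.+1).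
  rewrite -{1}(vpy N.+1) (le_trans (nrmM _ _)) // ler_wpM2r ?nrm_ge0 //.
  by rewrite (le_trans (nrmM _ _)) // ler_wpM2r ?nrm_ge0 // nrmXS.
have := ler_wpM2r (nrm_ge0 p) hN; rewrite mulrAC in h; lra.
Qed.

Lemma minimal_left_ideal_corner (ssA : semisimple A) (L : set A) :
  minimal_left_ideal L ->
  exists p (tau : A -> R[i]), [/\ p <> 0, p * p = p, L = [set x | x * p = x] &
    forall z, p * z * p = tau z *: p].
Proof.
move=> /(minimal_left_ideal_idempotent ssA) [p [p0 pp LE pdiv]].
have [tau tauP] := choice (corner_scalar p0 pp pdiv).
by exists p, tau.
Qed.

End GelfandMazur.

(** The elements sum_i s_i p t_i behave like finite rank operators, because p A p
is one-dimensional. *)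
Section FiniteRankSpectrum.
Variables (K : numFieldType) (A : unitAlgType K) (p : A) (tau : A -> K).
Hypotheses (p0 : p <> 0) (tauP : forall z, p * z * p = tau z *: p).
Implicit Types (s t : A) (l k : K).

Lemma scaler_idemI k l : k *: p = l *: p -> k = l.
Proof.
move/eqP; rewrite -subr_eq0 -scalerBl scaler_eq0 subr_eq0.
by case/orP => /eqP.
Qed.

(** The form tau is linear because it is determined by the values tau(z) p. *)
Lemma tau_affine x y l : tau (x + l *: y) = tau x + l * tau y.
Proof.
apply: scaler_idemI; rewrite -tauP mulrDr mulrDl -scalerAr -scalerAl !tauP.
by rewrite scalerDl scalerA.
Qed.

(** The transpose of the matrix of d = sum_i s_i p t_i acting on the family
s_i p by left multiplication; the transpose suits row eigenvectors. *)
Definition trace_mx n (s t : 'I_n -> A) : 'M[K]_n :=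
  \matrix_(i, j) tau (t j * s i).

Section FiniteRank.
Variables (n : nat) (s t : 'I_n -> A).

Let M := trace_mx s t.
Let d : A := \sum_(i < n) s i * p * t i.
(* This map turns multiplication by M into multiplication by d = of_mx 1, on the
   opposite side, which transports an inverse of M - l to one of d - l. *)
Let of_mx (B : 'M[K]_n) : A :=  \sum_(i < n) \sum_(j < n) B i j *: (s j * p * t i).

Lemma trace_mxE i j : p * (t j * s i) * p = M i j *: p.
Proof. by rewrite mxE tauP. Qed.

Lemma of_mx_cell (i j k l : 'I_n) :
  (s i * p * t k) * (s j * p * t l) = M j k *: (s i * p * t l).
Proof.
have -> : s i * p * t k * (s j * p * t l) = s i * (p * (t k * s j) * p) * t l.
  by rewrite !mulrA.
by rewrite trace_mxE -scalerAr -scalerAl.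
Qed.

Lemma of_mx1 : of_mx 1%:M = d.
Proof.
apply: eq_bigr => i _; rewrite (bigD1 i) //= big1 => [|j ji].
  by rewrite mxE eqxx scale1r addr0.
by rewrite mxE eq_sym (negbTE ji) scale0r.
Qed.

Lemma of_mxDZ B k C : of_mx (B + k *: C) = of_mx B + k *: of_mx C.
Proof.
rewrite scaler_sumr -big_split; apply: eq_bigr => i _ /=.
rewrite scaler_sumr -big_split; apply: eq_bigr => j _ /=.
by rewrite !mxE scalerDl scalerA.
Qed.

Lemma mul_of_mx B : d * of_mx B = of_mx (B *m M).
Proof.
rewrite mulr_sumr; apply: eq_bigr => i _.
rewrite /d mulr_suml.
apply: eq_bigr => k _; rewrite mxE scaler_suml mulr_sumr.
by apply: eq_bigr => j _; rewrite -scalerAr of_mx_cell scalerA.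
Qed.

Lemma of_mx_mul B : of_mx B * d = of_mx (M *m B).
Proof.
rewrite /d mulr_sumr; apply: eq_bigr => k _.
rewrite mulr_suml.
transitivity (\sum_(i < n) \sum_(j < n) (M k i * B i j) *: (s j * p * t k)).
  apply: eq_bigr => i _; rewrite mulr_suml; apply: eq_bigr => j _.
  by rewrite -scalerAl of_mx_cell scalerA mulrC.
rewrite exchange_big; apply: eq_bigr => j _ /=.
by rewrite mxE scaler_suml.
Qed.

(** If G inverts M - l, then W = of_mx G satisfies d W = W d = d + l W, so that
(1 - W) / l inverts l - d. Conversely, an eigenvector v of M gives an element
z = sum_i v_i s_i p with (l - d) z = 0, and z <> 0 because the products
p t_k z = l v_k p are not all 0. *)
Lemma finite_rank_spectrum l : l != 0 ->
  spectrum d l <-> root (char_poly M) l.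
Proof.
move=> l0; rewrite -eigenvalue_root_char /spectrum /=; split=> [ld|].
  apply: contrapT => /negP; rewrite negbK kermx_eq0 row_free_unit => Mu.
  move/negP: ld; apply.
  pose G := invmx (M - l%:M); pose W := of_mx G.
  have dW : d * W = d + l *: W.
    rewrite mul_of_mx -of_mx1 -of_mxDZ; congr of_mx.
    by rewrite -(mulVmx Mu) mulmxBr mul_mx_scalar subrK.
  have Wd : W * d = d + l *: W.
    rewrite of_mx_mul -[in RHS]of_mx1 -of_mxDZ; congr of_mx.
    by rewrite -(mulmxV Mu) mulmxBl mul_scalar_mx subrK.
  apply/unitrP; exists (l^-1 *: (1 - W)); split.
    rewrite -scalerAl mulrBl mul1r mulrBr -scalerAr mulr1 Wd.
    by rewrite opprB addrK subrK scalerA mulVf // scale1r.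
  rewrite -scalerAr mulrBr mulr1 mulrBl -scalerAl mul1r dW.
  by rewrite opprB addrK subrK scalerA mulVf // scale1r.
move/eigenvalueP => [v vM v0]; apply/negP => ld.
have vMi (k : 'I_n) : \sum_(i < n) v 0 i * M i k = l * v 0 k.
  by move/rowP: vM => /(_ k); rewrite !mxE.
pose z := \sum_(i < n) v 0 i *: (s i * p).
have dz : d * z = l *: z.
  rewrite mulr_suml scaler_sumr; apply: eq_bigr => k _.
  rewrite scalerA -vMi scaler_suml mulr_sumr; apply: eq_bigr => i _.
  rewrite -scalerAr -scalerA; congr (_ *: _).
  have -> : s k * p * t k * (s i * p) = s k * (p * (t k * s i) * p).
    by rewrite !mulrA.
  by rewrite trace_mxE -scalerAr.
have z0 : z = 0.
  by rewrite -(mulKr ld z) mulrBl dz -scalerAl mul1r subrr mulr0.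
case/eqP: v0; apply/rowP => k; rewrite mxE.
have : p * t k * z = (l * v 0 k) *: p.
  rewrite -vMi scaler_suml mulr_sumr; apply: eq_bigr => i _.
  by rewrite -scalerAr -scalerA -trace_mxE !mulrA.
rewrite z0 mulr0 => /esym /eqP; rewrite scaler_eq0 mulf_eq0 (negbTE l0) /=.
by case/orP => /eqP.
Qed.

End FiniteRank.

Lemma rank_one_spectrum s t l :
  nonzero_spectrum (s * p * t) l <-> l != 0 /\ l = tau (t * s).
Proof.
have key : l != 0 -> spectrum (s * p * t) l <-> l = tau (t * s).
  move=> l0; have := @finite_rank_spectrum 1 (fun=> s) (fun=> t) l l0.
  rewrite big_ord1 => ->; rewrite /char_poly det_mx11 !mxE eqxx mulr1n root_XsubC.
  by split=> /eqP.
split=> [[sl /eqP l0]|[l0 lE]]; split=> //; try exact/key; exact/eqP.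
Qed.

End FiniteRankSpectrum.

(** * From an open set to the whole algebra *)

Section SpectralMapping.
Variables (R : realType) (A : unitAlgType R[i]) (u : A).
Implicit Types (q f : {poly R[i]}) (l m : R[i]).

Let ev (q : {poly R[i]}) : A := horner_alg u q.

Lemma horner_algXsubC l : ev ('X - l%:P) = u - l%:A.
Proof. by rewrite /ev rmorphB /= horner_algX horner_algC. Qed.

Lemma horner_alg_1sub q m : ev (1 - m%:P * ('X * q)) = 1 - m *: (u * ev q).
Proof.
by rewrite /ev rmorphB rmorph1 !rmorphM /= horner_algX horner_algC -scalerAl mul1r.
Qed.

(** The polynomial f = 1 - m X q takes the value 1 at 0 and at the roots of q. Its
own roots l are thus outside the spectrum of u, and f(u) is a product of units
u - l up to a nonzero scalar. *)
Lemma annihilated_unit q m :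
  (forall l, nonzero_spectrum u l -> root q l) ->
  1 - m *: (u * ev q) \is a GRing.unit.
Proof.
move=> uq; pose f := 1 - m%:P * ('X * q).
have fE l : f.[l] = 1 - m * (l * q.[l]) by rewrite !hornerE.
rewrite -horner_alg_1sub -/f.
have f0 : f != 0.
  apply: contra_eq_neq (fE 0) => ->.
  by rewrite horner0 mul0r mulr0 subr0 eq_sym oner_neq0.
have [rs frs] := closed_field_poly_normal f.
rewrite frs -mul_polyC /ev rmorphM /= horner_algC -scalerAl mul1r rmorph_prod.
rewrite scaler_unit ?unitfE ?lead_coef_eq0 //.
rewrite big_seq; apply: rpred_prod => l lrs /=.
have -> : horner_alg u ('X - l%:P) = u - l%:A := horner_algXsubC l.
have fl : f.[l] = 0.
  by apply/eqP; rewrite -/(root f l) frs rootZ ?lead_coef_eq0 // root_prod_XsubC.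
rewrite -opprB unitrN; apply: contrapT => /negP ul.
have [l0|l0] := eqVneq l 0.
  by move: fl; rewrite fE l0 mul0r mulr0 subr0 => /eqP; rewrite oner_eq0.
have /uq /eqP ql : nonzero_spectrum u l by split=> //; exact/eqP.
by move: fl; rewrite fE ql !mulr0 subr0 => /eqP; rewrite oner_eq0.
Qed.

(** If q(l) <> 0, then 1 - m X q is divisible by X - l for m = 1 / (l q(l)), and
its value at u is a unit only if u - l is. *)
Lemma unit_annihilated q l :
  (forall m, 1 - m *: (u * ev q) \is a GRing.unit) ->
  nonzero_spectrum u l -> root q l.
Proof.
move=> uq [ul /= /eqP l0]; apply/eqP; apply: contrapT => /eqP ql.
case/negP: ul; have := uq (l * q.[l])^-1; set m := _^-1.
pose f := 1 - m%:P * ('X * q).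
have : root f l by rewrite /root !hornerE /m /= -mulrA mulVf ?subrr // mulf_neq0.
move=> /factor_theorem [g fg].
rewrite -horner_alg_1sub -/f.
have fl : ev f = ev g * (u - l%:A) by rewrite fg -horner_algXsubC -rmorphM.
have fr : ev f = (u - l%:A) * ev g.
  by rewrite fg mulrC -horner_algXsubC -rmorphM.
rewrite fl unitrM_comm; last by rewrite /GRing.comm -fl fr.
by case/andP=> _; rewrite -opprB unitrN.
Qed.

End SpectralMapping.

Section Globalization.
Variables (R : realType) (A : banachAlgType R[i]) (p : A) (tau : A -> R[i]).
Hypotheses (p0 : p <> 0) (tauP : forall z, p * z * p = tau z *: p).

Lemma open_ball_line (N : set A) x0 y : open N -> N x0 ->
  exists2 r : R, 0 < r & forall l : R[i], nrm l <= r -> N (x0 + l *: y).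
Proof.
move=> No Nx0; have /nbhs_ballP [e /= e0 eN] := open_nbhs_nbhs (conj No Nx0).
have eE : e = (complex.Re e)%:C by rewrite RRe_real // gtr0_real.
have Re0 : 0 < complex.Re e by move: e0; rewrite ltcE => /andP[].
have y0 := nrm_ge0 y.
exists (complex.Re e / (nrm y + 1)); first by rewrite divr_gt0 //; lra.
move=> l lr; apply: eN; rewrite -ball_normE /ball_ /=.
rewrite opprD addrA subrr add0r normrN normr_nrm eE ltcR nrmZ.
rewrite ler_pdivlMr in lr; last lra.
have := nrm_ge0 l; rewrite le_eqVlt => /orP[/eqP <-|l0]; first by rewrite mul0r.
by apply: lt_le_trans lr; rewrite ltr_pM2l //; lra.
Qed.

(** Along the line from a point x0 of N to x, the element u q_l(u), with
u = a (x0 + l y) and q_l the characteristic polynomial attached to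
b (x0 + l y), is a polynomial in l which is quasinilpotent for small l, hence
also for l = 1. *)
Lemma spectrum_inclusion_globalize a n (s t : 'I_n -> A) (N : set A) :
  let b := \sum_(i < n) s i * p * t i in
  open N -> N !=set0 ->
  (forall x, N x -> nonzero_spectrum (a * x) `<=` nonzero_spectrum (b * x)) ->
  forall x, nonzero_spectrum (a * x) `<=` nonzero_spectrum (b * x).
Proof.
move=> b No [x0 Nx0] NE x; pose y := x - x0.
have [r r0 rN] := open_ball_line y No Nx0.
pose xl (l : R[i]) := x0 + l *: y.
pose q l := char_poly (trace_mx tau s (fun i => t i * xl l)).
have bq l m : m != 0 -> spectrum (b * xl l) m <-> root (q l) m.
  move=> m0; rewrite -(finite_rank_spectrum p0 tauP) //.
  by rewrite mulr_suml; under eq_bigr do rewrite -mulrA.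
(* The coefficients of Q are the coefficients of q l as polynomials in l. *)
pose Q := char_poly (map_mx polyC (trace_mx tau s (fun i => t i * x0)) +
  'X *: map_mx polyC (trace_mx tau s (fun i => t i * y))) : {poly {poly R[i]}}.
have qQ l : q l = map_poly (horner_eval l) Q.
  rewrite map_char_poly; congr char_poly; apply/matrixP => i j.
  rewrite !mxE /= /horner_eval !hornerE.
  rewrite -(tau_affine p0 tauP) mulrDr mulrDl.
  by rewrite -scalerAr -scalerAl.
pose U : {poly A} := (a * x0)%:P + (a * y)%:P * 'X.
have UE l : U.[l%:A] = a * xl l.
  rewrite hornerD hornerMX !hornerC /xl (mulrDr a x0); congr (_ + _).
  by rewrite -scalerAr mulr1 scalerAr.
pose P := U * \sum_(k < size Q) map_poly (in_alg A) Q`_k * U ^+ k.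
have PE l : P.[l%:A] = a * xl l * horner_alg (a * xl l) (q l).
  rewrite horner_scalarM UE; congr (_ * _).
  rewrite horner_sum /horner_alg /horner_morph.
  rewrite (@horner_coef_wide _ (size Q)); last first.
    by rewrite size_map_poly /q /Q !size_char_poly.
  apply: eq_bigr => k _; rewrite horner_scalarM horner_scalarXn UE.
  congr (_ * _); rewrite qQ !coef_map /=.
  by rewrite -[l%:A]/(in_alg A l) horner_map.
have Pqn l m : 1 - m *: P.[l%:A] \is a GRing.unit.
  have -> : m *: P.[l%:A] = ((m%:A)%:P * P).[l%:A].
    by rewrite (horner_scalarM (m%:A)%:P) hornerC -scalerAl mul1r.
  apply: (quasinilpotent_extension r0) => {}l lr k.
  rewrite (horner_scalarM (m%:A)%:P) hornerC -scalerAl mul1r scalerA PE.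
  apply: annihilated_unit => z /(NE _ (rN _ lr)) [bz /eqP z0].
  exact/bq.
have x1 : xl 1 = x by rewrite /xl scale1r /y addrC subrK.
rewrite -x1 => m am; have [_ /= /eqP m0] := am.
split; last exact/eqP.
apply/bq => //; apply: unit_annihilated am => k.
by rewrite -PE.
Qed.
End Globalization.

(** * Inclusion of spectra and minimality of the socle *)

(** An additive group is not the union of two proper subgroups: take x outside P
and y outside Q; then x + y lies in neither. *)
Lemma subtractive_cover (V : zmodType) (P Q : V -> Prop) :
  (forall x y, P y -> P (x + y) -> P x) ->
  (forall x y, Q x -> Q (x + y) -> Q y) ->
  (forall x, P x \/ Q x) -> (forall x, P x) \/ (forall x, Q x).
Proof.
move=> Psub Qsub PQ; apply: contrapT => /not_orP[/existsNP[x Px] /existsNP[y Qy]].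
have [//|Qx] := PQ x; have [Py|//] := PQ y.
by have [/(Psub _ _ Py)|/(Qsub _ _ Qx)] := PQ (x + y).
Qed.

Lemma simple_socle_sumP (A : unitRingType) p b :
  minimal_two_sided_ideal (socle A) -> socle A p -> p <> 0 -> socle A b ->
  exists n (s t : 'I_n -> A), b = \sum_(i < n) s i * p * t i.
Proof.
move=> [[[S0 SD SM] SMr] Smin] Sp p0 Sb.
pose I : set A := [set x | exists r : seq (A * A), x = \sum_(u <- r) u.1 * p * u.2].
have II : two_sided_ideal I.
  split; first split.
  - by exists [::]; rewrite big_nil.
  - by move=> _ _ [r ->] [r' ->]; exists (r ++ r'); rewrite big_cat.
  - move=> a _ [r ->]; exists [seq (a * u.1, u.2) | u <- r].
    by rewrite big_map mulr_sumr; apply: eq_bigr => u _; rewrite !mulrA.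
  - move=> _ a [r ->]; exists [seq (u.1, u.2 * a) | u <- r].
    by rewrite big_map mulr_suml; apply: eq_bigr => u _; rewrite !mulrA.
have IS : I `<=` socle A.
  move=> _ [r ->]; elim: r => [|u r IHr]; first by rewrite big_nil.
  by rewrite big_cons; apply: SD => //; apply: SMr; exact: SM.
have Ip : I p by exists [:: (1, 1)]; rewrite big_seq1 mul1r mulr1.
have [I0|IE] := Smin _ II IS; first by rewrite I0 in Ip.
have [r ->] : I b by rewrite IE.
exists (size r), (fun i => (tnth (in_tuple r) i).1), (fun i => (tnth (in_tuple r) i).2).
by rewrite big_tnth.
Qed.

Section Uniqueness.
Variables (R : realType) (A : banachAlgType R[i]).
Hypothesis ssA : semisimple A.
Implicit Types (a b c p : A).

(** The elements z of the socle with c A z = 0 form a two-sided ideal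
containing p. *)
Lemma simple_socle_annihilator c p :
  minimal_two_sided_ideal (socle A) -> socle A p -> p <> 0 ->
  (forall s, c * s * p = 0) -> forall z, socle A z -> forall y, c * y * z = 0.
Proof.
move=> [[[S0 SD SM] SMr] Smin] Sp p0 cp.
pose I : set A := [set z | socle A z /\ forall y, c * y * z = 0].
have II : two_sided_ideal I.
  split; first split.
  - by split=> // y; rewrite mulr0.
  - move=> z z' [Sz cz] [Sz' cz']; split=> [|y]; first exact: SD.
    by rewrite mulrDr cz cz' addr0.
  - move=> a z [Sz cz]; split=> [|y]; first exact: SM.
    by rewrite mulrA -(mulrA c y a) cz.
  - move=> z a [Sz cz]; split=> [|y]; first exact: SMr.
    by rewrite mulrA cz mul0r.
have IS : I `<=` socle A by move=> z [].
have [I0|IE] := Smin _ II IS.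
  by have : I p by []; rewrite I0 => /p0.
by move=> z; rewrite -IE => -[].
Qed.

(** The values at rank one elements s p t leave two cases, in which c = a or
c = a - b annihilates the socle; the elements y c z, which b annihilates from
the left, then show that c = 0. *)
Lemma spectrum_inclusion_eq a b : minimal_two_sided_ideal (socle A) ->
  a <> 0 -> socle A b -> b <> 0 ->
  (forall x, nonzero_spectrum (a * x) `<=` nonzero_spectrum (b * x)) -> a = b.
Proof.
move=> Smin a0 Sb b0 ab.
have [L Lm] := socle_minimal_left_ideal Sb b0.
have [p [tau [p0 pp LE tauP]]] := minimal_left_ideal_corner ssA Lm.
have Sp : socle A p by apply: (minimal_left_ideal_sub_socle Lm); rewrite LE.
have tauD x y : tau (x + y) = tau x + tau y.
  by rewrite -[y in LHS]scale1r (tau_affine p0 tauP) mul1r.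
have tau_eq0 u : (forall t, tau (t * u) = 0) -> u * p = 0.
  move=> tu; apply: (semisimple_semiprime ssA) => y.
  have -> : u * p * y * (u * p) = u * (p * (y * u) * p) by rewrite !mulrA.
  by rewrite tauP tu scale0r mulr0.
(* The nonzero spectra of a s p t and b s p t are contained in the singletons
   of tau (t a s) and tau (t b s). *)
have pointwise s t : tau (t * (a * s)) = 0 \/ tau (t * ((a - b) * s)) = 0.
  have [->|ts0] := eqVneq (tau (t * (a * s))) 0; [by left|right].
  have : nonzero_spectrum (a * s * p * t) (tau (t * (a * s))).
    by apply/(rank_one_spectrum p0 tauP).
  rewrite -!mulrA => /ab; rewrite !mulrA => /(rank_one_spectrum p0 tauP) [_ E].
  rewrite !mulrA in E.
  have := tauD (t * ((a - b) * s)) (t * b * s).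
  have -> : t * ((a - b) * s) + t * b * s = t * a * s.
    by rewrite mulrBl mulrBr !mulrA subrK.
  by rewrite E -[LHS]add0r => /addIr E2; rewrite -mulrA -E2.
have sub_tau u x y : tau (y * u) = 0 -> tau ((x + y) * u) = 0 -> tau (x * u) = 0.
  by move=> yu; rewrite mulrDl tauD yu addr0.
have column s : a * s * p = 0 \/ (a - b) * s * p = 0.
  have := @subtractive_cover _ (fun t => tau (t * (a * s)) = 0)
    (fun t => tau (t * ((a - b) * s)) = 0) (@sub_tau _) _ (fun t => pointwise s t).
  case=> [x y xu|/tau_eq0|/tau_eq0]; [|by left|by right].
  by rewrite addrC; exact: sub_tau.
have global : (forall s, a * s * p = 0) \/ (forall s, (a - b) * s * p = 0).
  apply: subtractive_cover column => x y h.
    by rewrite mulrDr mulrDl h addr0.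
  by rewrite mulrDr mulrDl h add0r.
suff eq0 c : (forall s, c * s * p = 0) ->
    (forall x, b * x = 0 -> a * x = c * x) -> c = 0.
  case: global => [ap|cp]; first by case: a0; exact: eq0.
  apply/eqP; rewrite -subr_eq0; apply/eqP/eq0 => // x bx.
  by rewrite mulrBl bx subr0.
move=> cp ac.
have cS := simple_socle_annihilator Smin Sp p0 cp.
have Sc z y : socle A z -> z * y * c = 0.
  move=> Sz; apply: (semisimple_semiprime ssA) => w.
  have -> : z * y * c * w * (z * y * c) = z * y * (c * w * z) * y * c.
    by rewrite !mulrA.
  by rewrite cS // mulr0 !mul0r.
apply: (semisimple_semiprime ssA) => y; apply: (semisimple_eq0 ssA) => z.
apply: unit_1subM_swap; apply: contrapT => /negP nu.
have bx : b * (y * c * z) = 0 by rewrite !mulrA Sc // mul0r.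
have /ab : nonzero_spectrum (a * (y * c * z)) 1.
  split; last exact/eqP/oner_neq0.
  by rewrite /spectrum /= scale1r ac // !mulrA.
by rewrite bx => -[]; rewrite /spectrum /= scale1r subr0 unitr1.
Qed.

(** As p x q x = q x p x = 0, the element l (l - (p + q) x) is the product of the
commuting factors l - p x and l - q x. *)
Lemma orthogonal_mulr_spectrum p q x :
  (forall y, p * y * q = 0) -> (forall y, q * y * p = 0) ->
  nonzero_spectrum (p * x) `<=` nonzero_spectrum ((p + q) * x).
Proof.
move=> pq qp l [pl l0]; split=> //; move: pl; rewrite /spectrum /=.
apply: contraNN => ul.
have l0' : l != 0 by exact/eqP.
have split_l u v : u * v = 0 ->
    (l%:A - u) * (l%:A - v) = l *: (l%:A - (u + v)) :> A.
  move=> uv; rewrite mulrBr [_ * v]mulrBl uv subr0 -scalerAr mulr1.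
  by rewrite -scalerAl mul1r -scalerBr opprD addrA.
have E1 := split_l (p * x) (q * x) ltac:(by rewrite mulrA pq mul0r).
have E2 := split_l (q * x) (p * x) ltac:(by rewrite mulrA qp mul0r).
have : (l%:A - p * x) * (l%:A - q * x) \is a GRing.unit.
  by rewrite E1 scaler_unit ?unitfE // -mulrDl.
rewrite unitrM_comm; first by case/andP.
by rewrite /GRing.comm E1 E2 (addrC (p * x)).
Qed.

(** A proper nonzero ideal J of the socle separates two minimal left ideals Ap
and Aq with p A q contained both in J and in Aq, hence 0. The pair p, p + q
violates uniqueness. *)
Lemma unique_inclusion_minimal :
  (forall a b, a <> 0 -> socle A b -> b <> 0 ->
    (forall x, nonzero_spectrum (a * x) `<=` nonzero_spectrum (b * x)) ->
    a = b) ->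
  minimal_two_sided_ideal (socle A).
Proof.
move=> uniq; have SI := socle_two_sided A; split=> // J JI JS.
apply: contrapT => /not_orP[J0 JnS].
have [L1 L1m L1J] := two_sided_ideal_minimal_left_ideal ssA JI JS J0.
have [JL JMr] := JI.
have [L2 L2m L2J] : exists2 L, minimal_left_ideal L & ~ (L `<=` J).
  apply: contrapT => nex; apply: JnS; apply/seteqP; split=> //.
  have [J00 JD _] := JL; apply: socle_ind => // L Lm.
  by apply: contrapT => LJ; apply: nex; exists L.
have [p [p0 pp L1E _]] := minimal_left_ideal_idempotent ssA L1m.
have [q [q0 qq L2E _]] := minimal_left_ideal_idempotent ssA L2m.
have L1p : L1 p by rewrite L1E.
have L2q : L2 q by rewrite L2E.
have pq y : p * y * q = 0.
  apply: (minimal_left_ideal_setI JL L2m L2J).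
    exact: (JMr _ _ (JMr _ _ (L1J _ L1p))).
  by case: L2m => -[_ _ L2M] _ _; exact: L2M.
have qp y : q * y * p = 0.
  apply: (semisimple_semiprime ssA) => z.
  have -> : q * y * p * z * (q * y * p) = q * y * (p * z * q) * y * p.
    by rewrite !mulrA.
  by rewrite pq mulr0 !mul0r.
have pq0 : p + q <> 0.
  move=> E; apply: p0; have : p * (p + q) = 0 by rewrite E mulr0.
  by rewrite mulrDr pp -[X in X * q]mulr1 pq addr0.
have [[_ SD _] _] := SI.
have pE : p = p + q.
  apply: uniq => //.
    apply: SD; first exact: (minimal_left_ideal_sub_socle L1m).
    exact: (minimal_left_ideal_sub_socle L2m).
  by move=> x; exact: orthogonal_mulr_spectrum.
by apply: q0; apply: (addrI p); rewrite addr0 -pE.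
Qed.

End Uniqueness.

Theorem theorem2p16 (R : realType) (A : banachAlgType R[i])
    (ssA : semisimple A) :
  minimal_two_sided_ideal (socle A) <->
  (forall a b : A, a != 0 -> socle A b -> b != 0 ->
    [<-> (exists N : set A, [/\ open N, N !=set0 &
            forall x, N x ->
              nonzero_spectrum (a * x) `<=` nonzero_spectrum (b * x)]);
         (forall x : A,
              nonzero_spectrum (a * x) `<=` nonzero_spectrum (b * x));
         a = b]).
Proof.
split=> [Smin a b /eqP a0 Sb /eqP b0|equiv].
  tfae.
  - move=> [N [No N0 NE]].
    have [L Lm] := socle_minimal_left_ideal Sb b0.
    have [p [tau [p0 pp LE tauP]]] := minimal_left_ideal_corner ssA Lm.
    have Sp : socle A p by apply: (minimal_left_ideal_sub_socle Lm); rewrite LE.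
    have [n [s [t bE]]] := simple_socle_sumP Smin Sp p0 Sb.
    by move: NE; rewrite bE; exact: spectrum_inclusion_globalize.
  - exact: spectrum_inclusion_eq.
  - by move=> ->; exists setT; split=> [||x _]; [exact: openT|exists 0|].
apply: unique_inclusion_minimal => // a b a0 Sb b0 ab.
have /eqP a0' := a0; have /eqP b0' := b0.
by case: (equiv a b a0' Sb b0') => _ [/(_ ab)].
Qed.
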